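(* Let $(x_m,y_m)_{m\in[M]}\in(\mathcal X\times\mathbb R_+)^M$ be such that the matrix $\mathbf K_{\phi,\hat X}=[k_\phi(x_i,x_j)]_{i,j\in[M]}$ is invertible. Then there exists $A\in S^+(\mathscr H_\phi)$ such that $y_m=\langle\phi(x_m),A\phi(x_m)\rangle_{\mathscr H_\phi}$ for all $m\in[M]$, and $$\mathrm{tr}(A)=\mathrm{tr}\big(\mathrm{diag}(\mathbf y)\mathbf K_{\phi,\hat X}^{-1}\big)\le\min\Big(\|\mathbf y\|_\infty\,\mathrm{tr}(\mathbf K_{\phi,\hat X}^{-1}),\ \|\mathbf y\|_1\,\lambda_{\min}(\mathbf K_{\phi,\hat X})^{-1}\Big),$$ where $\mathbf y=(y_m)_{m\in[M]}$ and $\lambda_{\min}(\mathbf K_{\phi,\hat X})$ is the smallest eigenvalue of $\mathbf K_{\phi,\hat X}$.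
   Context: $\mathcal X$ is a set, $k_\phi:\mathcal X\times\mathcal X\to\mathbb R$ is a (symmetric) positive semidefinite kernel with real reproducing kernel Hilbert space $\mathscr H_\phi$ and feature map $\phi(x)=k_\phi(x,\cdot)\in\mathscr H_\phi$. $S^+(\mathscr H_\phi)$ is the cone of positive semidefinite self-adjoint operators on $\mathscr H_\phi$, $\mathrm{tr}$ denotes the trace, $[M]=\{1,\dots,M\}$, $\mathbb R_+=[0,\infty)$, and $\hat X=\{x_m\}_{m\in[M]}$. *)

(* Defs.v *)
From HB Require Import structures.
From mathcomp Require Export all_boot all_order all_algebra.
From mathcomp Require Export all_classical all_reals all_analysis.
Export Order.TTheory GRing.Theory Num.Theory.
Export numFieldNormedType.Exports.

Set Implicit Arguments.
Unset Strict Implicit.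
Unset Printing Implicit Defensive.

#[export] Set Implicit Arguments.
#[export] Unset Strict Implicit.
#[export] Unset Printing Implicit Defensive.

Local Open Scope classical_set_scope.
Local Open Scope ring_scope.

(* A real Hilbert space is a Banach space whose norm comes from an inner
   product: a symmetric ([idfun]-hermitian), positive definite bilinear form. *)
Record hilbert (R : realType) := Hilbert {
  hilbert_sort :> completeNormedModType R;
  inner : {dot hilbert_sort for idfun};
  inner_norm : forall v : hilbert_sort, inner v v = `|v| ^+ 2 }.

Notation "''<' u , v '>'" := (inner _ u v)
  (at level 2, u at level 59, v at level 59, format "''<' u ,  v '>'")
  : ring_scope.

(* Self-adjointness is for bounded, everywhere defined operators. *)
Definition psd_operator (R : realType) (H : hilbert R)
    (A : {linear H -> H}) : Prop :=
  [/\ continuous A,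
      (forall u v : H, '<A u, v> = '<u, A v>) &
      (forall u : H, 0 <= '<u, A u>)].

(* H is not assumed separable, so B may be uncountable. *)
Definition orthonormal_basis (R : realType) (H : hilbert R) (B : set H) : Prop :=
  (forall e f, B e -> B f -> '<e, f> = (e == f)%:R) /\
  (forall v, (forall e, B e -> '<e, v> = 0) -> v = 0).

(* [is_trace A t]: tr(A) = t, for A positive semidefinite. All the terms
   <e, A e> are nonnegative, so the (possibly uncountable) sum is well-defined
   in [0, +oo]. Demanding the value t for every orthonormal basis builds in
   the independence of the basis; [orthonormal_basis_exists] below shows that
   the condition is never vacuous. *)
Definition is_trace (R : realType) (H : hilbert R) (A : {linear H -> H})
    (t : \bar R) : Prop :=
  forall B : set H, orthonormal_basis B ->
    (\esum_(e in B) ('<e, A e>)%:E)%E = t.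

Definition psd_kernel (R : realType) (X : Type) (k : X -> X -> R) : Prop :=
  (forall x y, k x y = k y x) /\
  (forall (n : nat) (x : 'I_n -> X) (c : 'I_n -> R),
     0 <= \sum_i \sum_j c i * c j * k (x i) (x j)).

(* A reproducing kernel Hilbert space of k is a Hilbert space of functions
   X -> R: its elements are identified with functions through the injective
   linear map [feval]. [feature x] is the element which is the function
   k(x, .). *)
Record rkhs (R : realType) (X : Type) (k : X -> X -> R) := Rkhs {
  rkhs_sort :> hilbert R;
  feval : {linear rkhs_sort -> (X -> R)};
  feval_inj : injective feval;
  feature : X -> rkhs_sort;
  featureE : forall x, feval (feature x) = k x;
  reproducing : forall f x, '<f, feature x> = feval f x }.

Definition gram_mx (R : realType) (X : Type) (k : X -> X -> R) (M : nat)
    (x : 'I_M -> X) : 'M[R]_M :=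
  \matrix_(i, j) k (x i) (x j).

(* The set of eigenvalues is finite, and nonempty for a symmetric real matrix
   of positive size, so the infimum is then a minimum. *)
Definition lambda_min (R : realType) (M : nat) (K : 'M[R]_M) : R :=
  inf [set a | eigenvalue K a].

Definition norm_inf (R : realType) (M : nat) (y : 'rV[R]_M) : R :=
  \big[Num.max/0]_(m < M) `|y 0 m|.

Definition norm_one (R : realType) (M : nat) (y : 'rV[R]_M) : R :=
  \sum_(m < M) `|y 0 m|.

Section Existence.
Variables (R : realType) (H : hilbert R).

Let orthonormal_set (B : set H) :=
  forall e f : H, B e -> B f -> '<e, f> = (e == f)%:R.

Lemma innerC (u v : H) : '<u, v> = '<v, u>.
Proof. by rewrite hermC /= expr0 mul1r. Qed.

Lemma orthonormal_basis_exists : exists B : set H, orthonormal_basis B.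
Proof.
have [|B [oB maxB]] := @Zorn_bigcup H [set B | orthonormal_set B].
  move=> F Fo Ftot e f [P FP Pe] [Q FQ Qf].
  have [PQ|QP] := Ftot _ _ FP FQ.
    by apply: (Fo _ FQ) => //; exact: PQ.
  by apply: (Fo _ FP) => //; exact: QP.
exists B; split => // v vB; apply: contrapT => v0.
have nv0 : `|v| != 0 by rewrite normr_eq0; apply/eqP.
pose w : H := `|v|^-1 *: v.
have wB e : B e -> '<e, w> = 0 by move=> Be; rewrite linearZr_LR /= vB ?mulr0.
have ww : '<w, w> = 1.
  by rewrite /w linearZr_LR linearZl_LR /= inner_norm expr2 mulKf ?mulVf.
have nBw : ~ B w by move=> /wB/eqP; rewrite ww oner_eq0.
apply: (maxB (B `|` [set w])).
  by split; [exact: subsetUl|move=> /(_ w) h; apply/nBw/h; right].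
move=> e f [Be|->] [Bf|->].
- exact: oB.
- by rewrite wB//; case: eqP => // ew; case: nBw; rewrite -ew.
- by rewrite innerC wB//; case: eqP => // wf; case: nBw; rewrite wf.
- by rewrite eqxx ww.
Qed.

Lemma is_trace_unique (A : {linear H -> H}) (s t : \bar R) :
  is_trace A s -> is_trace A t -> s = t.
Proof.
by have [B oB] := orthonormal_basis_exists; move=> /(_ B oB) <- /(_ B oB).
Qed.

End Existence.

(* Main.v *)
From HB Require Import structures.
Require Import Defs.
From mathcomp Require Import finmap.
From mathcomp.analysis.showcase Require Import summability.
From mathcomp Require Import ring lra.

(** Because the Gram matrix K is invertible, the features phi(x_m) have a dual
    family u_m in their span: <u_m, phi(x_i)> is 1 if m = i and 0 otherwise, and
    the Gram matrix of the u_m is the inverse of K ([dual_family]). The operator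
    is the sum of rank-one operators A = sum_m y_m u_m (x) u_m. Duality gives
    <phi(x_m), A phi(x_m)> = y_m at once. Writing w_m = sqrt(y_m) u_m, one has
    A = sum_m w_m (x) w_m, which is visibly positive semidefinite.

    For the trace, <e, A e> = sum_m <w_m, e>^2, so summing over an orthonormal
    basis turns every term into the squared norm of w_m by Parseval's identity,
    and sum_m |w_m|^2 = sum_m y_m (K^-1)_mm = tr(diag(y) K^-1). The bases may be
    uncountable, so Parseval's identity ([parseval]) is proved with the net of
    partial sums indexed by finite subsets: this net is Cauchy because the sums
    of squared coefficients are bounded, and its limit has the same coefficients
    as v, hence is v.

    The two upper bounds are obtained term by term. The first uses
    (K^-1)_mm = |u_m|^2 >= 0 and y_m <= |y|_oo. The second needs
    (K^-1)_mm <= 1 / lambda_min(K). This follows from the Rayleigh inequality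
    lambda_min(K) |z|^2 <= z K z^T ([rayleigh_lambda_min]) at the m-th row
    z of K^-1, since z K z^T = (K^-1)_mm and |z|^2 >= (K^-1)_mm ^ 2. *)

Local Open Scope classical_set_scope.
Local Open Scope ring_scope.

(** * Quadratic forms and the smallest eigenvalue *)

Definition quad_form (R : realType) (n : nat) (K : 'M[R]_n) (z : 'rV[R]_n) : R :=
  (z *m K *m z^T) 0 0.

Section QuadraticForms.
Variables (R : realType) (n : nat).
Implicit Types (K N : 'M[R]_n) (z w : 'rV[R]_n).

Lemma quad_formE K z :
  quad_form K z = \sum_i \sum_j z 0 i * z 0 j * K i j.
Proof.
rewrite /quad_form mxE exchange_big /=; apply: eq_bigr => j _.
by rewrite !mxE mulr_suml; apply: eq_bigr => i _; rewrite mulrAC.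
Qed.

Lemma quad_form_scalar a z : quad_form a%:M z = a * \sum_i z 0 i ^+ 2.
Proof.
rewrite /quad_form mul_mx_scalar -scalemxAl mxE mxE.
by congr (_ * _); apply: eq_bigr => i _; rewrite mxE expr2.
Qed.

Lemma quad_formB K N z : quad_form (K - N) z = quad_form K z - quad_form N z.
Proof. by rewrite /quad_form mulmxBr mulmxBl !mxE. Qed.

Lemma quad_formN K z : quad_form (- K) z = - quad_form K z.
Proof. by rewrite /quad_form mulmxN mulNmx mxE. Qed.

Lemma quad_form_eigen K z a : z *m K = a *: z ->
  quad_form K z = a * \sum_i z 0 i ^+ 2.
Proof. by move=> zK; rewrite -quad_form_scalar /quad_form zK mul_mx_scalar. Qed.

Lemma sumsq_gt0 z : z != 0 -> 0 < \sum_i z 0 i ^+ 2.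
Proof.
move=> z0; rewrite lt_neqAle sumr_ge0 ?andbT => [|i _]; last exact: sqr_ge0.
rewrite eq_sym psumr_neq0; last by move=> i _; exact: sqr_ge0.
case/rV0Pn: z0 => i zi; apply/hasP; exists i; first by rewrite mem_index_enum.
by rewrite /= lt_neqAle sqr_ge0 andbT eq_sym sqrf_eq0.
Qed.

(** Each term satisfies 2 |z_i z_j| <= z_i^2 + z_j^2 <= 2 |z|^2. The extra 1 in
    the constant makes it positive, so that it can be inverted. *)
Lemma quad_form_bounded N :
  exists2 c, 0 < c & forall z, quad_form N z <= c * \sum_i z 0 i ^+ 2.
Proof.
exists (1 + \sum_i \sum_j `|N i j|).
  by rewrite ltr_pwDl// sumr_ge0// => i _; rewrite sumr_ge0.
move=> z; set q := \sum_i z 0 i ^+ 2.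
have q0 : 0 <= q by apply: sumr_ge0 => i _; exact: sqr_ge0.
apply: (@le_trans _ _ ((\sum_i \sum_j `|N i j|) * q)); last first.
  by rewrite ler_wpM2r// lerDr.
rewrite quad_formE mulr_suml; apply: ler_sum => i _.
rewrite mulr_suml; apply: ler_sum => j _.
have zq l : z 0 l ^+ 2 <= q.
  by rewrite /q (bigD1 l)//= lerDl sumr_ge0// => ? _; exact: sqr_ge0.
apply: le_trans (ler_norm _) _; rewrite normrM mulrC ler_wpM2l//.
rewrite ler_norml; have := zq i; have := zq j.
have := sqr_ge0 (z 0 i + z 0 j); have := sqr_ge0 (z 0 i - z 0 j).
by rewrite sqrrB sqrrD; lra.
Qed.

(** With c a bound for the form of K^-1, positivity of K at the point
    z - c^-1 z K^-1 reads
    0 <= z K z^T - 2 c^-1 |z|^2 + c^-2 z K^-1 z^T <= z K z^T - c^-1 |z|^2,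
    so c^-1 is a coercivity constant. *)
Lemma quad_form_coercive K : K^T = K -> K \in unitmx ->
    (forall z, 0 <= quad_form K z) ->
  exists2 d, 0 < d & forall z, d * \sum_i z 0 i ^+ 2 <= quad_form K z.
Proof.
move=> Ksym Kunit Kpsd.
have [c c0 Nc] := quad_form_bounded (invmx K).
exists c^-1; first by rewrite invr_gt0.
move=> z; set q := \sum_i z 0 i ^+ 2.
have zz : z *m z^T = q%:M.
  apply/matrixP => i j; rewrite !ord1 !mxE eqxx mulr1n.
  by apply: eq_bigr => l _; rewrite mxE expr2.
have iKsym : (invmx K)^T = invmx K by rewrite trmx_inv Ksym.
have -> : quad_form K z
  = quad_form K (z - c^-1 *: (z *m invmx K)) + 2 * c^-1 * q
    - c^-1 ^+ 2 * quad_form (invmx K) z.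
  have zT : (z - c^-1 *: (z *m invmx K))^T = z^T - c^-1 *: (invmx K *m z^T).
    by rewrite linearB /= linearZ /= trmx_mul iKsym.
  rewrite /quad_form zT.
  rewrite !(mulmxBl, mulmxBr) -!scalemxAl -!scalemxAr -!mulmxA.
  rewrite (mulmxA K (invmx K)) (mulmxA (invmx K) K) mulmxV// mulVmx// !mul1mx.
  rewrite zz !mxE eqxx mulr1n; ring.
have := Kpsd (z - c^-1 *: (z *m invmx K)); have := Nc z; rewrite -/q => h1 h2.
have : c^-1 ^+ 2 * quad_form (invmx K) z <= c^-1 * q.
  apply: le_trans (ler_wpM2l (sqr_ge0 _) h1) _.
  by rewrite expr2 mulrA -(mulrA _ _ c) mulVf ?mulr1// gt_eqF.
by lra.
Qed.

End QuadraticForms.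

(** Let s be the supremum of the t such that
    K - t I is positive semidefinite; then K - s I is positive semidefinite too.
    If s were not an eigenvalue, K - s I would be invertible, hence coercive, and
    s could be increased. As every eigenvalue is at least s, s is the smallest
    one. *)
Lemma rayleigh_lambda_min (R : realType) (n : nat) (K : 'M[R]_n) :
    (0 < n)%N -> K^T = K ->
  eigenvalue K (lambda_min K) /\
  forall z : 'rV_n, lambda_min K * \sum_i z 0 i ^+ 2 <= quad_form K z.
Proof.
move=> n0 Ksym.
pose S := [set t | forall z : 'rV_n, t * \sum_i z 0 i ^+ 2 <= quad_form K z].
have S_sup : has_sup S.
  split.
    have [c _ Nc] := quad_form_bounded (- K).
    by exists (- c) => z; have := Nc z; rewrite quad_formN mulNr; lra.
  pose e : 'rV[R]_n := delta_mx 0 (Ordinal n0).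
  exists (quad_form K e / \sum_i e 0 i ^+ 2) => t /(_ e) te.
  rewrite ler_pdivlMr//; apply: sumsq_gt0; apply/rV0Pn.
  by exists (Ordinal n0); rewrite mxE !eqxx oner_neq0.
have supS : S (sup S).
  move=> z; have [->|z0] := eqVneq z 0.
    rewrite /quad_form mul0mx mul0mx mxE big1 ?mulr0// => i _.
    by rewrite mxE expr0n.
  rewrite -ler_pdivlMr ?sumsq_gt0//; apply: ge_sup; first exact: S_sup.1.
  by move=> t /(_ z); rewrite ler_pdivlMr ?sumsq_gt0.
have eigS : eigenvalue K (sup S).
  apply: contraT => nev.
  have unitKS : K - (sup S)%:M \in unitmx.
    by move: nev; rewrite /eigenvalue /eigenspace negbK kermx_eq0 row_free_unit.
  have [|||d d0 dP] := @quad_form_coercive _ _ (K - (sup S)%:M) => //.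
  - by rewrite linearB /= tr_scalar_mx Ksym.
  - by move=> z; rewrite quad_formB quad_form_scalar subr_ge0.
  have : S (sup S + d).
    by move=> z; have := dP z; rewrite quad_formB quad_form_scalar mulrDl; lra.
  by move=> /(ub_le_sup S_sup.2); lra.
suff -> : lambda_min K = sup S by [].
have lbS : lbound [set a | eigenvalue K a] (sup S).
  move=> a /eigenvalueP[v vK v0]; rewrite -(ler_pM2r (sumsq_gt0 v0)).
  by rewrite -(quad_form_eigen vK); exact: supS.
apply/eqP; rewrite eq_le; apply/andP; split.
  by apply: ge_inf; [exists (sup S)|exact: eigS].
by apply: lb_le_inf; [exists (sup S)|exact: lbS].
Qed.

(** Let z be the m-th row of K^-1 and t = (K^-1)_mm, which is both z K z^T and the
    m-th entry of z. The Rayleigh inequality gives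
    lambda_min(K) t^2 <= lambda_min(K) |z|^2 <= t. *)
Lemma invmx_diag_le_lambda_min (R : realType) (n : nat) (K : 'M[R]_n) (m : 'I_n) :
    K^T = K -> K \in unitmx -> (forall z, 0 <= quad_form K z) ->
  invmx K m m <= (lambda_min K)^-1.
Proof.
move=> Ksym Kunit Kpsd.
have [eigK leK] := rayleigh_lambda_min (leq_ltn_trans (leq0n m) (ltn_ord m)) Ksym.
have lK0 : 0 < lambda_min K.
  have [d d0 dK] := quad_form_coercive Ksym Kunit Kpsd.
  case/eigenvalueP: eigK => v vK v0; apply: (lt_le_trans d0).
  by rewrite -(ler_pM2r (sumsq_gt0 v0)) -(quad_form_eigen vK).
pose z : 'rV[R]_n := row m (invmx K).
have qz : quad_form K z = invmx K m m.
  by rewrite /quad_form /z -row_mul mulVmx// row1 -rowE !mxE.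
have z2 : invmx K m m ^+ 2 <= \sum_i z 0 i ^+ 2.
  by rewrite (bigD1 m)//= mxE lerDl sumr_ge0// => i _; exact: sqr_ge0.
have := leK z; rewrite qz => leKz.
have [t0|t0] := leP (invmx K m m) 0.
  by apply: le_trans t0 _; rewrite invr_ge0 ltW.
rewrite -[_^-1]mul1r ler_pdivlMr// -(ler_pM2l t0) mulr1 mulrA -expr2 mulrC.
by apply: le_trans leKz; rewrite ler_wpM2l// ltW.
Qed.

(** * Bessel's inequality and Parseval's identity *)

Section Hilbert.
Variables (R : realType) (H : hilbert R).
Implicit Types (u v : H) (B : set H).

Lemma sqr_normB u v : `|u - v| ^+ 2 = `|u| ^+ 2 - 2 * '<u, v> + `|v| ^+ 2.
Proof.
rewrite -!inner_norm !(linearDl, linearDr, linearNl, linearNr) /= (innerC v u).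
by ring.
Qed.

Lemma inner_polarization u v :
  '<u, v> = (`|u + v| ^+ 2 - `|u - v| ^+ 2) / 4.
Proof.
rewrite -!inner_norm !(linearDl, linearDr, linearNl, linearNr) /= (innerC v u).
by field.
Qed.

(** Polarization reduces the continuity of the inner product to that of the
    norm. *)
Lemma inner_continuous u : continuous (fun v : H => '<u, v>).
Proof.
have -> : (fun v : H => '<u, v>) =
    (fun v => (`|u + v| ^+ 2 - `|u - v| ^+ 2) / 4).
  by apply/funext => v; exact: inner_polarization.
move=> v; apply: cvgMr_tmp; apply: cvgB.
- apply: (continuous_cvg _ (@exprn_continuous _ 2 _)); apply: cvg_norm.
  by apply: cvgD; [exact: cvg_cst|exact: cvg_id].
- apply: (continuous_cvg _ (@exprn_continuous _ 2 _)); apply: cvg_norm.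
  by apply: cvgB; [exact: cvg_cst|exact: cvg_id].
Qed.

Lemma inner_cvg (T : Type) (F : set_system T) {FF : Filter F} (f : T -> H) u v :
  f @ F --> v -> (fun t => '<u, f t>) @ F --> '<u, v>.
Proof. by move=> fv; apply: (continuous_cvg _ (@inner_continuous u v)). Qed.

Definition orthosum (a : H -> R) (F : {fset H}) : H := \sum_(e <- F) a e *: e.

(** [a] plays the part of the coefficient family of a vector. It vanishes outside
    [B], so that partial sums can range over all finite subsets of [H] instead of
    those of [B]. *)
Section OrthonormalSystem.
Variables (B : set H) (a : H -> R).
Hypothesis oB : forall e f, B e -> B f -> '<e, f> = (e == f)%:R.
Hypothesis aB : forall e, ~ B e -> a e = 0.
Implicit Types (F G : {fset H}).

Lemma inner_orthosum F e : B e ->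
  '<e, orthosum a F> = if e \in F then a e else 0.
Proof.
move=> Be; rewrite /orthosum linear_sumr /=.
have eqt f : '<e, a f *: f> = if f == e then a e else 0.
  rewrite linearZr_LR /=; have [Bf|nBf] := pselect (B f).
    rewrite oB// eq_sym; case: eqP => [->|_]; first by rewrite mulr1.
    by rewrite mulr0.
  rewrite aB// mul0r; case: eqP => // fe.
  by move: nBf; rewrite fe.
under eq_bigr do rewrite eqt.
have [eF|eF] := boolP (e \in F).
  rewrite (big_fsetD1 e)//= eqxx big_seq big1 ?addr0// => f.
  by rewrite in_fsetD1 => /andP[/negbTE -> _].
by rewrite big_seq big1// => f fF; case: eqP => // fe; move: eF; rewrite -fe fF.
Qed.

Lemma inner_orthosum_self v F : (forall e, e \in F -> B e -> '<e, v> = a e) ->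
  '<orthosum a F, v> = \sum_(e <- F) a e ^+ 2.
Proof.
move=> va; rewrite /orthosum linear_sumlz /= big_seq [RHS]big_seq.
apply: eq_bigr => e eF; rewrite linearZl_LR /=.
have [Be|nBe] := pselect (B e); first by rewrite va// expr2.
by rewrite aB// mul0r expr0n.
Qed.

Lemma orthosum_norm F : `|orthosum a F| ^+ 2 = \sum_(e <- F) a e ^+ 2.
Proof.
rewrite -inner_norm inner_orthosum_self// => e eF Be.
by rewrite inner_orthosum// eF.
Qed.

Lemma orthosumB_norm F G : (F `<=` G)%fset ->
  `|orthosum a G - orthosum a F| ^+ 2 =
  \sum_(e <- G) a e ^+ 2 - \sum_(e <- F) a e ^+ 2.
Proof.
move=> FG; rewrite sqr_normB !orthosum_norm.
have GF : '<orthosum a F, orthosum a G> = \sum_(e <- F) a e ^+ 2.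
  apply: inner_orthosum_self => e eF Be.
  by rewrite inner_orthosum// (fsubsetP FG).
by rewrite innerC GF; lra.
Qed.

Lemma bessel v F : (forall e, B e -> '<e, v> = a e) ->
  \sum_(e <- F) a e ^+ 2 <= `|v| ^+ 2.
Proof.
move=> va; have Fv := inner_orthosum_self (v := v) (F := F) (fun e _ => va e).
have := sqr_ge0 `|v - orthosum a F|; rewrite sqr_normB innerC Fv.
by rewrite orthosum_norm; lra.
Qed.

(** Between nested index sets, the squared distance of the partial sums is the
    difference of the sums of squares; the latter is small once the smaller set
    nearly attains the supremum. *)
Lemma cvg_orthosum : has_sup (range (fun F => \sum_(e <- F) a e ^+ 2)) ->
  cvg (orthosum a @ totally).
Proof.
set s := fun F => _; move=> sups.
have totF : ProperFilter (@totally H) by exact: totally_filter.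
apply/cauchy_cvgP/cauchy_exP => eps eps0.
have [_ [F _ <-] Feps] := sup_adherent (exprn_gt0 2 eps0) sups.
exists (orthosum a F), F => // G FG.
rewrite /= -ball_normE /ball_ /= distrC.
rewrite -(ltr_pXn2r (n := 2))// ?nnegrE ?(ltW eps0)//.
rewrite orthosumB_norm//; have : s G <= sup (range s).
  by apply: (ub_le_sup sups.2); exists G.
by rewrite -/(s F) -/(s G); lra.
Qed.

End OrthonormalSystem.

(** The partial sums of the expansion of v converge to a vector p with the same
    coefficients as v, so p = v by totality of the basis. Pairing with v, the
    partial sums of squares converge to |v|^2, which inherits their bound. *)
Lemma parseval_le B v t : orthonormal_basis B ->
    (forall F : {fset H},
      \sum_(e <- F) (if e \in B then '<e, v> else 0) ^+ 2 <= t) ->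
  `|v| ^+ 2 <= t.
Proof.
move=> [oB totB]; pose a e := if e \in B then '<e, v> else 0.
pose s (F : {fset H}) := \sum_(e <- F) a e ^+ 2.
rewrite -/(forall F, s F <= t) => st.
have aB e : ~ B e -> a e = 0.
  by move=> nBe; rewrite /a; case: ifPn => // /set_mem.
have aE e : B e -> a e = '<e, v> by move=> /mem_set Be; rewrite /a Be.
have totF : ProperFilter (@totally H) by exact: totally_filter.
have sups : has_sup (range s).
  by split; [exists (s fset0), fset0|exists t => _ [F _ <-]; exact: st].
have /cvg_ex[p pP] := cvg_orthosum oB aB sups.
have pv : p = v.
  apply/eqP; rewrite -subr_eq0; apply/eqP/totB => e Be.
  rewrite linearB /=; apply/eqP; rewrite subr_eq0 -aE//; apply/eqP.
  have ep : ('<e, orthosum a F> : R) @[F --> totally] --> ('<e, p> : R).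
    exact: inner_cvg pP.
  (* The net of coefficients at e is constant once the index set contains e. *)
  apply: (norm_cvg_unique ep); apply: cvg_near_cst.
  exists [fset e]%fset => // F /=; rewrite fsub1set => eF.
  by rewrite (inner_orthosum oB aB)// eF.
have sv : ('<v, orthosum a F> : R) @[F --> totally] --> `|v| ^+ 2.
  by rewrite -inner_norm -{3}pv; exact: inner_cvg pP.
apply: (cvgr_to_le sv); apply: nearW => F.
rewrite innerC (inner_orthosum_self aB) ?st// => e _ Be.
by rewrite -aE.
Qed.

(** The sum over the basis is rewritten as a sum over the whole space of the
    coefficients extended by zero. Bessel's inequality bounds it by |v|^2 (so it is
    finite), and [parseval_le] applied to its value gives the converse. *)
Lemma parseval B v : orthonormal_basis B ->
  (\esum_(e in B) (('<e, v>) ^+ 2)%:E)%E = (`|v| ^+ 2)%:E.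
Proof.
move=> oB; pose a e := if e \in B then '<e, v> else 0.
have -> : (\esum_(e in B) (('<e, v>) ^+ 2)%:E)%E =
          (\esum_(e in [set: H]) (a e ^+ 2)%:E)%E.
  rewrite esum_mkcond; apply: eq_esum => e _; rewrite /a.
  by case: ifP; rewrite // expr0n.
apply/eqP; rewrite eq_le; apply/andP; split.
  apply: ge_ereal_sup => _ [A [finA _] <-].
  rewrite fsumEFin// lee_fin fsbig_finite//=; apply: (@bessel B a oB.1).
    by move=> e nBe; rewrite /a; case: ifPn => // /set_mem.
  by move=> e /mem_set Be; rewrite /a Be.
rewrite leNgt; apply/negP => lt_v.
have s_le (F : {fset H}) : ((\sum_(e <- F) a e ^+ 2)%:E <=
               \esum_(e in [set: H]) (a e ^+ 2)%:E)%E.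
  apply: esum_ge; exists [set` F].
    by split; [exact: finite_fset|exact: subsetT].
  by rewrite fsumEFin// fsbig_finite//= set_fsetK.
have s_ge0 : (0 <= \esum_(e in [set: H]) (a e ^+ 2)%:E)%E.
  by apply: esum_ge0 => e _; rewrite lee_fin sqr_ge0.
move: lt_v s_le s_ge0; case: (\esum_(e in _) _)%E => [t lt_v s_le _| |] //.
move: lt_v; rewrite lte_fin ltNge => /negP; apply.
by apply: (parseval_le oB) => F; rewrite -lee_fin.
Qed.

(** * Sums of rank-one operators *)

Section FiniteRankOperator.
Variables (M : nat) (w : 'I_M -> H).

Definition rank_one_sum v : H := \sum_m '<w m, v> *: w m.

Lemma rank_one_sum_linear : linear rank_one_sum.
Proof.
move=> c u v; rewrite /rank_one_sum scaler_sumr -big_split /=.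
apply: eq_bigr => m _.
by rewrite linearDr linearZr_LR /= scalerDl scalerA.
Qed.

HB.instance Definition _ :=
  GRing.isLinear.Build R H H _ rank_one_sum rank_one_sum_linear.

Lemma inner_rank_one_sum u v :
  '<u, rank_one_sum v> = \sum_m '<w m, u> * '<w m, v>.
Proof.
rewrite /rank_one_sum linear_sumr /=; apply: eq_bigr => m _.
by rewrite linearZr_LR /= mulrC (innerC u).
Qed.

Lemma rank_one_sum_psd : psd_operator rank_one_sum.
Proof.
split.
- apply: (@continuous_big H 'I_M +%R 0 xpredT (@add_continuous H)) => m _ v.
  by apply: cvgZr_tmp; exact: inner_continuous.
- move=> u v; rewrite innerC !inner_rank_one_sum.
  by apply: eq_bigr => m _; rewrite mulrC.
- move=> u; rewrite inner_rank_one_sum; apply: sumr_ge0 => m _.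
  by rewrite -expr2 sqr_ge0.
Qed.

Lemma rank_one_sum_trace : is_trace rank_one_sum (\sum_m `|w m| ^+ 2)%:E.
Proof.
move=> B oB; under eq_esum do rewrite inner_rank_one_sum -sumEFin.
rewrite esum_sum => [|e m _ _]; last by rewrite lee_fin -expr2 sqr_ge0.
rewrite -sumEFin; apply: eq_bigr => m _; rewrite -(parseval _ oB).
by apply: eq_esum => e _; rewrite -expr2 innerC.
Qed.

End FiniteRankOperator.

(** The rows of G^-1 are the coordinates of the dual vectors
    u_m = sum_j (G^-1)_mj v_j. By duality |u_m|^2 is the coefficient of u_m along
    v_m, that is (G^-1)_mm. *)
Lemma dual_family (M : nat) (v : 'I_M -> H) :
    let G := \matrix_(i, j) '<v i, v j> in G \in unitmx ->
  exists u : 'I_M -> H, (forall m i, '<u m, v i> = (m == i)%:R) /\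
    forall m, `|u m| ^+ 2 = invmx G m m.
Proof.
move=> G Gunit; pose u m := \sum_j invmx G m j *: v j.
have uv m i : '<u m, v i> = (m == i)%:R.
  rewrite /u linear_sumlz /=.
  transitivity ((invmx G *m G) m i); last by rewrite mulVmx// mxE.
  by rewrite mxE; apply: eq_bigr => j _; rewrite linearZl_LR /= mxE.
exists u; split => // m.
rewrite -inner_norm {2}/u linear_sumr /= (bigD1 m)//= linearZr_LR /= uv eqxx.
rewrite mulr1 big1 ?addr0// => j jm.
by rewrite linearZr_LR /= uv eq_sym (negbTE jm) mulr0.
Qed.

End Hilbert.

(** * Interpolation by a positive semidefinite operator *)

Theorem lemma1 (R : realType) (X : Type) (k : X -> X -> R)
  (k_psd : psd_kernel k) (H : rkhs k)
  (M : nat) (x : 'I_M -> X) (y : 'rV[R]_M)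
  (y_ge0 : forall m, 0 <= y 0 m)
  (K_inv : gram_mx k x \in unitmx) :
  let K := gram_mx k x in
  exists A : {linear H -> H},
    [/\ psd_operator A,
        (forall m, y 0 m = '<feature H (x m), A (feature H (x m))>),
        is_trace A (\tr (diag_mx y *m invmx K))%:E &
        \tr (diag_mx y *m invmx K) <=
          Num.min (norm_inf y * \tr (invmx K))
                  (norm_one y * (lambda_min K)^-1)].
Proof.
move=> K; pose phi m := feature H (x m).
have gramE : \matrix_(i, j) '<phi i, phi j> = K.
  by apply/matrixP => i j; rewrite !mxE reproducing featureE.
have [|u [u_phi u_norm]] := dual_family (v := phi); first by rewrite gramE.
rewrite gramE in u_norm.
have Ksym : K^T = K by apply/matrixP => i j; rewrite !mxE k_psd.1.
have Kpsd z : 0 <= quad_form K z.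
  rewrite quad_formE; under eq_bigr do under eq_bigr do rewrite mxE.
  exact: k_psd.2.
(* The square root makes each rank-one term y_m u_m (x) u_m of the form
   w_m (x) w_m, so that the weights need no separate treatment. *)
pose w m : H := Num.sqrt (y 0 m) *: u m.
have trE : \tr (diag_mx y *m invmx K) = \sum_m y 0 m * invmx K m m.
  by apply: eq_bigr => m _; rewrite mul_diag_mx mxE.
exists (rank_one_sum w); split.
- exact: rank_one_sum_psd.
- move=> m; rewrite inner_rank_one_sum (bigD1 m)//= big1 => [|i im].
    by rewrite linearZl_LR /= u_phi eqxx mulr1 addr0 -expr2 sqr_sqrtr.
  by rewrite linearZl_LR /= u_phi (negbTE im) mulr0 mul0r.
- rewrite trE; have -> : \sum_m y 0 m * invmx K m m = \sum_m `|w m| ^+ 2.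
    apply: eq_bigr => m _.
    by rewrite normrZ exprMn real_normK ?num_real// sqr_sqrtr// u_norm.
  exact: rank_one_sum_trace.
- rewrite trE le_min; apply/andP; split.
    rewrite mulr_sumr; apply: ler_sum => m _.
    rewrite ler_wpM2r ?[invmx K m m](esym (u_norm m)) ?sqr_ge0//.
    by apply: le_trans (ler_norm _) _; exact: le_bigmax.
  rewrite mulr_suml; apply: ler_sum => m _; rewrite ger0_norm//.
  by rewrite ler_wpM2l//; exact: invmx_diag_le_lambda_min.
Qed.
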